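(* Let $f$ be $\rho$-weakly convex and $r$ be $\eta$-weakly convex on $\mathbb{X}$ with $\rho,\eta\ge0$, and let $0<\lambda<\frac{1}{\rho+2\eta}$. Let $\{x^k\}$ be generated by Prox-SubGrad for $\min_{x\in\mathbb{X}}\varphi(x)=f(x)+r(x)$. Suppose that $\{\varphi_\lambda(x^k)\}$ converges to $\bar\varphi$, where $\bar\varphi=\varphi_\lambda(\bar x)$ is a local minimum value of $\varphi$, and that $\varphi_\lambda$ satisfies the uniform KL property on $\Omega=\{x\in\mathbb{X}\mid\varphi_\lambda(x)=\bar\varphi\}$, i.e., there is $\kappa_{uKL}^{\varphi_\lambda}>0$ such that (for some $\epsilon,\nu>0$) $$\|\nabla\varphi_\lambda(x)\|^2\ge\kappa_{uKL}^{\varphi_\lambda}[\varphi_\lambda(x)-\bar\varphi]\qquad\forall x\in\mathfrak{B}(\bar\varphi,\epsilon,\nu)=\{x\in\mathbb{X}\mid\mathrm{dist}(x,\Omega)\le\epsilon,\ \bar\varphi<\varphi_\lambda(x)<\bar\varphi+\nu\}.$$ Suppose one of the conditions (B$_{\text{D-D}}$), (B$_3$), (B$_4$) holds, and that the diminishing stepsizes are $\alpha_k=\beta_k$, with $\beta_k<\frac{1}{2(\frac1\lambda+2\eta+\rho)}$ in case (B$_{\text{D-D}}$) and $\beta_k<\frac{1}{6\eta}$ in cases (B$_3$), (B$_4$), and $\beta_k=\frac{\Delta_2}{k}$ with a sufficiently large positive number $\Delta_2$. Then $$\varphi_\lambda(x^k)-\bar\varphi=O\Big(\frac1k\Big).$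$
   Context: Setting: $\mathbb{X}\subseteq\mathbb{R}^d$ is closed and convex; $f,r:\mathbb{X}\to\mathbb{R}$ are proper and lower semicontinuous; $\varphi=f+r$; the set $\mathbb{X}^*$ of minimizers of $\varphi$ over $\mathbb{X}$ is non-empty and $\varphi^*$ is the minimum value. A function $u:\mathbb{X}\to\mathbb{R}$ is $\rho$-weakly convex if $\theta=u+\frac{\rho}{2}\|\cdot\|^2$ is convex; then $\partial u(x)=\partial\theta(x)-\rho x$, where $\partial\theta(x)=\{v:\theta(y)\ge\theta(x)+\langle v,y-x\rangle\ \forall y\in\mathbb{X}\}$. Moreau envelope: $\varphi_\lambda(x)=\min_{y\in\mathbb{X}}\{\varphi(y)+\frac{1}{2\lambda}\|y-x\|^2\}$, with unique minimizer $\mathrm{Prox}_{\lambda,\varphi}(x)$, and $\nabla\varphi_\lambda(x)=\frac1\lambda(x-\mathrm{Prox}_{\lambda,\varphi}(x))$. Prox-SubGrad: starting from $x^0\in\mathbb{X}$, for $k=0,1,\dots$ pick $g(x^k)\in\partial f(x^k)$ and a step size $\alpha_k>0$, and set $x^{k+1}=\arg\min_{x\in\mathbb{X}}\langle g(x^k),x\rangle+r(x)+\frac{1}{2\alpha_k}\|x-x^k\|^2$. Conditions (for all $x\in\mathbb{X}$, $g(x)\in\partial f(x)$, $h(x)\in\partial r(x)$): (B$_{\text{D-D}}$) $\|g(x)\|\le L_f$ for a constant $L_f$; (B$_3$) $\|g(x)+h(x)\|\le\sqrt{c_3[\varphi_\lambda(x)-\varphi^*]+c_4}$ for some $c_3,c_4\ge0$;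 (B$_4$) $\|g(x)+h(x)\|\le\sqrt{c_5\|\nabla\varphi_\lambda(x)\|^2+c_6}$ for some $c_5,c_6\ge0$ (this implies (B$_3$)). Convention: $1/(6\eta)=+\infty$ if $\eta=0$ (and $\frac{1}{\rho+2\eta}=+\infty$ if $\rho=\eta=0$).
   Formalization: Adds that dist(x^k,Ω) ≤ ε for all large k (automatic if {x^k} is bounded); without it the claim fails, e.g. f=x²/(1+x⁴), r=0 on R with x^k→∞. Also β_k=Δ₂/k is required only for all large k. *)

(* Defs.v *)
From HB Require Import structures.
From mathcomp Require Import all_boot all_order all_algebra.
From mathcomp Require Import all_classical all_reals all_analysis.

Set Implicit Arguments.
Unset Strict Implicit.
Unset Printing Implicit Defensive.

Import Order.TTheory GRing.Theory Num.Theory.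
Import numFieldNormedType.Exports.

Local Open Scope classical_set_scope.
Local Open Scope ring_scope.

(* Points of R^d are row vectors.  The library norm on 'rV[R]_d is the sup
   norm; it induces the Euclidean topology, but wherever the value of a norm
   matters the Euclidean norm [enorm] below is used instead.
   A function on X is a total function whose values outside X are never
   looked at. *)

Section Euclidean.
Context {R : realType} {d : nat}.
Implicit Types (x y u v : 'rV[R]_d) (X A : set 'rV[R]_d).

Definition dotp u v : R := \sum_(i < d) u ord0 i * v ord0 i.

Definition enorm u : R := Num.sqrt (dotp u u).

(* Only meaningful for nonempty A. *)
Definition dist_to x A : R := inf [set enorm (x - y) | y in A].

(* [subspace X] carries the topology induced on X, with the points outside X
   made isolated. *)
Definition lsc_on X (phi : 'rV[R]_d -> R) : Prop :=
  lower_semicontinuous ((fun x => (phi x)%:E) : subspace X -> \bar R).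

Definition quad_shift (rho : R) (phi : 'rV[R]_d -> R) x : R :=
  phi x + rho / 2 * enorm x ^+ 2.

Definition weakly_convex X (rho : R) (phi : 'rV[R]_d -> R) : Prop :=
  convex_function X (quad_shift rho phi).

Definition cvx_subdiff X (theta : 'rV[R]_d -> R) x : set 'rV[R]_d :=
  [set v | forall y, X y -> theta x + dotp v (y - x) <= theta y].

Definition subdiff X (rho : R) (phi : 'rV[R]_d -> R) x : set 'rV[R]_d :=
  [set v - rho *: x | v in cvx_subdiff X (quad_shift rho phi) x].

Definition argmin X (phi : 'rV[R]_d -> R) : set 'rV[R]_d :=
  [set x | X x /\ forall y, X y -> phi x <= phi y].

Definition min_value X (phi : 'rV[R]_d -> R) (m : R) : Prop :=
  exists2 x, argmin X phi x & phi x = m.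

Definition local_min_value X (phi : 'rV[R]_d -> R) (m : R) : Prop :=
  exists x, [/\ X x, phi x = m &
    exists2 delta : R, 0 < delta &
      forall y, X y -> enorm (y - x) < delta -> phi x <= phi y].

(* The minimum over y in X, written as an infimum, for every x in R^d (so that
   the gradient below makes sense at boundary points of X too). *)
Definition moreau X (lambda : R) (phi : 'rV[R]_d -> R) x : R :=
  inf [set phi y + (2 * lambda)^-1 * enorm (y - x) ^+ 2 | y in X].

Definition gradient (phi : 'rV[R]_d -> R) x : 'rV[R]_d :=
  \row_(i < d) 'D_(delta_mx ord0 i) phi x.

Definition uniform_KL X (phi : 'rV[R]_d -> R) (phibar kappa eps nu : R)
    : Prop :=
  let Omega := [set x | X x /\ phi x = phibar] in
  forall x, X x -> dist_to x Omega <= eps ->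
    phibar < phi x -> phi x < phibar + nu ->
    kappa * (phi x - phibar) <= enorm (gradient phi x) ^+ 2.

Definition prox_subgrad X (rho : R) (f r : 'rV[R]_d -> R)
    (x g : nat -> 'rV[R]_d) (alpha : nat -> R) : Prop :=
  X (x 0%N) /\
  forall k, [/\ subdiff X rho f (x k) (g k), 0 < alpha k &
    argmin X (fun y => dotp (g k) y + r y
                       + (2 * alpha k)^-1 * enorm (y - x k) ^+ 2) (x k.+1)].

Definition cond_BDD X (rho : R) (f : 'rV[R]_d -> R) : Prop :=
  exists Lf : R, forall x g, X x -> subdiff X rho f x g -> enorm g <= Lf.

Definition cond_B3 X (rho eta lambda phistar : R) (f r : 'rV[R]_d -> R)
    : Prop :=
  exists c3 c4 : R, [/\ 0 <= c3, 0 <= c4 &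
    forall x g h, X x -> subdiff X rho f x g -> subdiff X eta r x h ->
      enorm (g + h) <=
        Num.sqrt (c3 * (moreau X lambda (f \+ r) x - phistar) + c4)].

Definition cond_B4 X (rho eta lambda : R) (f r : 'rV[R]_d -> R) : Prop :=
  exists c5 c6 : R, [/\ 0 <= c5, 0 <= c6 &
    forall x g h, X x -> subdiff X rho f x g -> subdiff X eta r x h ->
      enorm (g + h) <=
        Num.sqrt (c5 * enorm (gradient (moreau X lambda (f \+ r)) x) ^+ 2
                  + c6)].

(* [stepsize_bound b]: one of the three conditions holds and b is the upper
   bound on the stepsizes attached to it.  The inverse on \bar R satisfies
   0^-1 = +oo, which is the convention 1/(6 eta) = +oo for eta = 0. *)
Definition stepsize_bound X (rho eta lambda phistar : R)
    (f r : 'rV[R]_d -> R) (b : \bar R) : Prop :=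
  (cond_BDD X rho f /\ b = ((2 * (lambda^-1 + 2 * eta + rho))^-1)%:E) \/
  ((cond_B3 X rho eta lambda phistar f r \/ cond_B4 X rho eta lambda f r) /\
   b = ((6 * eta)%:E^-1)%E).

End Euclidean.

(* Main.v *)
(* The Moreau envelope decreases along the method: comparing the subproblem at
   [x k] with the prox point of [x k], via the growth of a strongly convex
   function away from its minimizer, gives
     phi_l (x k.+1) <= phi_l (x k) - c alpha_k |grad phi_l (x k)|^2 + E alpha_k^2
   with c = (1 - lambda (rho + 2 eta)) / 2 > 0; under (B_DD) the subgradients of
   f at two successive iterates are bounded, under (B_3) the sum g + h is bounded
   because phi_l (x k) converges.  With the KL inequality, the gap
   a_k = phi_l (x k) - phibar obeys a_{k+1} <= (1 - 2/k) a_k + C/k^2 whenever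
   a_k > 0 and Delta_2 >= 2 / (c kappa), which gives a_k <= M/k.  Since nothing
   forces phi_l (x k) >= phibar, the matching lower bound comes from summing
   a_{k+1} <= a_k + C/k^2 up to the limit 0. *)
Require Import Defs.
From HB Require Import structures.
From mathcomp Require Import all_boot all_order all_algebra.
From mathcomp Require Import all_classical all_reals all_analysis.
From mathcomp Require Import ring lra.

Set Implicit Arguments.
Unset Strict Implicit.
Unset Printing Implicit Defensive.

Import Order.TTheory GRing.Theory Num.Theory.
Import numFieldNormedType.Exports.

Local Open Scope classical_set_scope.
Local Open Scope ring_scope.

(** * Bilinearity of the dot product and elementary quadratic inequalities *)

Section DotProduct.
Context {R : realType} {d : nat}.
Implicit Types (u v w : 'rV[R]_d).

Lemma dotpC u v : dotp u v = dotp v u.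
Proof. by apply: eq_bigr => i _; rewrite mulrC. Qed.

Lemma dotpDl u v w : dotp (u + v) w = dotp u w + dotp v w.
Proof. by rewrite -big_split; apply: eq_bigr => i _; rewrite mxE mulrDl. Qed.

Lemma dotpZl (a : R) u v : dotp (a *: u) v = a * dotp u v.
Proof. by rewrite /dotp mulr_sumr; apply: eq_bigr => i _; rewrite mxE mulrA. Qed.

Lemma dotpNl u v : dotp (- u) v = - dotp u v.
Proof. by rewrite -scaleN1r dotpZl mulN1r. Qed.

Lemma dotpDr u v w : dotp u (v + w) = dotp u v + dotp u w.
Proof. by rewrite dotpC dotpDl !(dotpC u). Qed.

Lemma dotpZr (a : R) u v : dotp u (a *: v) = a * dotp u v.
Proof. by rewrite dotpC dotpZl dotpC. Qed.

Lemma dotpNr u v : dotp u (- v) = - dotp u v.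
Proof. by rewrite dotpC dotpNl dotpC. Qed.

Definition dotpE := (dotpDl, dotpDr, dotpNl, dotpNr, dotpZl, dotpZr).

Lemma dotp_ge0 u : 0 <= dotp u u.
Proof. by apply: sumr_ge0 => i _; rewrite -expr2 sqr_ge0. Qed.

Lemma dotp0 u : dotp u 0 = 0.
Proof. by rewrite -(scale0r (0 : 'rV[R]_d)) dotpZr mul0r. Qed.

Lemma enorm_sqr u : enorm u ^+ 2 = dotp u u.
Proof. by rewrite sqr_sqrtr // dotp_ge0. Qed.

Lemma enorm_ge0 u : 0 <= enorm u.
Proof. exact: sqrtr_ge0. Qed.

Lemma dotp_delta u i : dotp u (delta_mx ord0 i) = u ord0 i.
Proof.
rewrite /dotp (bigD1 i) //= mxE !eqxx mulr1 big1 ?addr0 // => j ji.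
by rewrite mxE eqxx (negbTE ji) mulr0.
Qed.

Lemma sqr_coord_le u i : u ord0 i ^+ 2 <= dotp u u.
Proof.
rewrite /dotp (bigD1 i) //= expr2 lerDl; apply: sumr_ge0 => j _.
by rewrite -expr2 sqr_ge0.
Qed.

(** Expand [0 <= |2 t u + v|^2] and divide by [4 t]. *)
Lemma dotp_young (t : R) u v : 0 < t ->
  - (t * dotp u u + (4 * t)^-1 * dotp v v) <= dotp u v.
Proof.
move=> t0; have := dotp_ge0 ((2 * t) *: u + v).
rewrite !dotpE (dotpC v u) => H.
have {}H : 0 <= (4 * t)^-1 * (2 * t * (2 * t * dotp u u) + 2 * t * dotp u v +
    (2 * t * dotp u v + dotp v v)).
  by rewrite mulr_ge0 ?invr_ge0; lra.
suff E : (4 * t)^-1 * (2 * t * (2 * t * dotp u u) + 2 * t * dotp u v +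
    (2 * t * dotp u v + dotp v v)) = t * dotp u u + (4 * t)^-1 * dotp v v + dotp u v.
  lra.
by field; rewrite gt_eqF.
Qed.

Lemma dotp_sum_sqr_le u v : dotp (u + v) (u + v) <= 2 * dotp u u + 2 * dotp v v.
Proof. have := dotp_ge0 (u - v); rewrite !dotpE (dotpC v u); lra. Qed.

(** Library balls are sup-norm balls, so the dual factor is the l1 norm of [u]. *)
Lemma dotp_ball_ge u w e : (forall i, `|w ord0 i| <= e) ->
  - ((\sum_(i < d) `|u ord0 i|) * e) <= dotp u w.
Proof.
move=> we; rewrite mulr_suml -sumrN; apply: ler_sum => i _.
apply: lerNnormlW; rewrite normrM; exact: ler_wpM2l.
Qed.

End DotProduct.

(** * Strong convexity, quadratic growth at minimizers, existence of minimizers *)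

Section StrongConvexity.
Context {R : realType} {d : nat}.
Implicit Types (x y a u v : 'rV[R]_d) (X : set 'rV[R]_d) (F G : 'rV[R]_d -> R).

(** The modulus may be negative: [- rho] encodes [rho]-weak convexity, so that moduli simply add in
    a sum of weakly convex functions and proximal terms. *)
Definition strongly_convex X (mu : R) F := forall x y (t : R), X x -> X y ->
  0 <= t <= 1 -> F (t *: x + (1 - t) *: y) <=
    t * F x + (1 - t) * F y - mu / 2 * (t * (1 - t)) * dotp (x - y) (x - y).

Lemma convex_setP X x y (t : R) : convex_set X -> X x -> X y -> 0 <= t <= 1 ->
  X (t *: x + (1 - t) *: y).
Proof.
move=> cX Xx Xy t01.
have /(_ _ _) := cX x y (Itv01 (andP t01).1 (andP t01).2).
by rewrite !inE => /(_ Xx Xy).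
Qed.

Lemma dotp_conv_sqr x y a (t : R) :
  let z := t *: x + (1 - t) *: y - a in
  dotp z z = t * dotp (x - a) (x - a) + (1 - t) * dotp (y - a) (y - a)
             - t * (1 - t) * dotp (x - y) (x - y).
Proof.
rewrite /= !dotpE (dotpC y x) (dotpC a x) (dotpC a y); ring.
Qed.

Lemma strongly_convex_quad X a (c : R) :
  strongly_convex X c (fun y => c / 2 * enorm (y - a) ^+ 2).
Proof.
by move=> x y t _ _ _; rewrite !enorm_sqr dotp_conv_sqr; lra.
Qed.

Lemma strongly_convex_dotp X u : strongly_convex X 0 (dotp u).
Proof. by move=> x y t _ _ _; rewrite !dotpE; lra. Qed.

Lemma strongly_convexD X (mu nu : R) F G :
  strongly_convex X mu F -> strongly_convex X nu G ->
  strongly_convex X (mu + nu) (fun y => F y + G y).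
Proof.
move=> sF sG x y t Xx Xy t01.
have := sF x y t Xx Xy t01; have := sG x y t Xx Xy t01; lra.
Qed.

Lemma weakly_convex_strongly X (rho : R) F :
  weakly_convex X rho F -> strongly_convex X (- rho) F.
Proof.
move=> wF x y t Xx Xy t01.
have /(_ _ _) := wF (Itv01 (andP t01).1 (andP t01).2) x y.
rewrite !inE => /(_ Xx Xy).
rewrite convRE /= /quad_shift /conv /= /unstable.onem !enorm_sqr.
have := dotp_conv_sqr x y 0 t; rewrite /= !subr0 => ->; lra.
Qed.

Lemma argmin_growth X (mu : R) F p y : convex_set X -> strongly_convex X mu F ->
  argmin X F p -> X y -> F p + mu / 2 * dotp (y - p) (y - p) <= F y.
Proof.
move=> cX sF [Xp pmin] Xy; rewrite leNgt; apply/negP => H.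
set D := dotp (y - p) (y - p) in H *; set A := mu / 2 * D in H *.
have Fpy := pmin y Xy.
(* The negated claim reads [F y < F p + A], and [F p <= F y]. *)
have A0 : 0 < A by lra.
(* Moving from [p] towards [y] by [t] gives [(1 - t) * A <= F y - F p]. This [t] makes [t * A] half
   of the deficit [A - (F y - F p)], which is too small for that. *)
pose t := (A - (F y - F p)) / (2 * A).
have t0 : 0 < t by rewrite divr_gt0; lra.
have t1 : t <= 1 by rewrite ler_pdivrMr; lra.
have t01 : 0 <= t <= 1 by rewrite (ltW t0).
have := sF y p t Xy Xp t01.
have := pmin _ (convex_setP cX Xy Xp t01).
rewrite -/D => H1 H2.
have H3 : 0 <= t * (F y - F p - (1 - t) * A).
  by apply: le_trans (_ : _ <= t * F y + (1 - t) * F p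
    - mu / 2 * (t * (1 - t)) * D - F p) _; rewrite /A; lra.
rewrite pmulr_rge0 // in H3.
have E : t * A = (A - (F y - F p)) / 2 by rewrite /t; field; rewrite gt_eqF.
lra.
Qed.

Definition lsc_ball X F := forall x (a : R), X x -> a < F x ->
  exists2 e : R, 0 < e & forall y, X y -> ball x e y -> a < F y.

Lemma lsc_onP X F : lsc_on X F -> lsc_ball X F.
Proof.
move=> lF x a Xx axF.
have [|V] := lF x a; first by rewrite lte_fin.
rewrite /nbhs /= -nbhs_subspace_in // => /nbhs_ballP[e e0 xeV] VF.
exists e => // y Xy xy; have := VF y (xeV y xy Xy).
by rewrite lte_fin.
Qed.

Lemma lsc_ballD X F G : lsc_ball X F -> lsc_ball X G ->
  lsc_ball X (fun y => F y + G y).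
Proof.
move=> lF lG x a Xx axF.
pose h := (F x + G x - a) / 2.
have [||e e0 He] := lF x (F x - h) => //; first by rewrite /h; lra.
have [||e' e'0 He'] := lG x (G x - h) => //; first by rewrite /h; lra.
exists (Num.min e e'); first by rewrite lt_min e0.
move=> y Xy xy.
have /(He y Xy) : ball x e y by apply: le_ball xy; rewrite ge_min lexx.
have /(He' y Xy) : ball x e' y by apply: le_ball xy; rewrite ge_min lexx orbT.
by rewrite /h; lra.
Qed.

Lemma lsc_ball_quad X a (c : R) : 0 <= c ->
  lsc_ball X (fun y => c * enorm (y - a) ^+ 2).
Proof.
move=> c0 x b Xx bx.
set S := \sum_(i < d) `|(x - a) ord0 i|.
have S0 : 0 <= S by apply: sumr_ge0.
pose h := c * enorm (x - a) ^+ 2 - b.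
have h0 : 0 < h by rewrite /h; lra.
have k0 : 0 < 2 * c * S + 1 by have := mulr_ge0 c0 S0; lra.
(* On this ball the linear term of the expansion around [x] costs at most [2 * c * S * e < h]; the
   [+ 1] keeps the denominator positive. *)
exists (h / (2 * c * S + 1)); first exact: divr_gt0.
set e := _ / _ => y Xy [e0 xy].
have : - (S * e) <= dotp (x - a) (y - x).
  by apply: dotp_ball_ge => i; have := xy ord0 i; rewrite /ball /= !mxE distrC => /ltW.
have E : dotp (y - a) (y - a) =
  dotp (x - a) (x - a) + 2 * dotp (x - a) (y - x) + dotp (y - x) (y - x).
  rewrite !dotpE (dotpC y x) (dotpC a x) (dotpC a y); ring.
have := dotp_ge0 (y - x).
rewrite enorm_sqr E => H1 H2.
have He : e * (2 * c * S + 1) = h by rewrite /e divfK // gt_eqF.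
have : 0 <= c * (dotp (y - x) (y - x) + 2 * (dotp (x - a) (y - x) + S * e)).
  by apply: mulr_ge0 => //; lra.
move: He; rewrite /h enorm_sqr; lra.
Qed.

(* A minimizing sequence of a strongly convex function is Cauchy. *)
Lemma argmin_exists X (mu m : R) F : closed X -> convex_set X -> X !=set0 ->
  0 < mu -> strongly_convex X mu F -> lsc_ball X F ->
  (forall y, X y -> m <= F y) -> exists p, argmin X F p.
Proof.
move=> clX cX [x0 Xx0] mu0 sF lF Fm.
pose A := [set F y | y in X].
have A0 : A !=set0 by exists (F x0), x0.
have Alb : has_lbound A by exists m => _ [y Xy <-]; exact: Fm.
pose I := inf A.
have Ilb y : X y -> I <= F y by move=> Xy; apply: ge_inf => //; exists y.
have near_I (n : nat) : exists y, X y /\ F y < I + n.+1%:R^-1.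
  have n0 : 0 < n.+1%:R^-1 :> R by rewrite invr_gt0.
  have [_ [y Xy <-] ylt] := inf_adherent n0 (conj A0 Alb).
  by exists y.
have [y_ Hy] := choice near_I.
(* The midpoint of [y_ n] and [y_ k] has value at least [I], so strong convexity with [t = 1/2]
   bounds their distance by how far both values exceed [I]. *)
have close n k i : (y_ n ord0 i - y_ k ord0 i) ^+ 2 <= 4 / mu * (n.+1%:R^-1 + k.+1%:R^-1).
  have [Xn Fn] := Hy n; have [Xk Fk] := Hy k.
  have h01 : 0 <= (2^-1 : R) <= 1 by lra.
  have := sF _ _ _ Xn Xk h01.
  have := Ilb _ (convex_setP cX Xn Xk h01).
  have := sqr_coord_le (y_ n - y_ k) i; rewrite !mxE.
  set D := dotp _ _ => H1 H2 H3.
  move: H2 H3 Fk Fn; set M := F (_ + _).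
  move: (n.+1%:R^-1) (k.+1%:R^-1) => a b H2 H3 Fk Fn.
  have H4 : mu * D <= 4 * (a + b) by lra.
  apply: le_trans H1 _; rewrite mulrAC ler_pdivlMr //; lra.
have : cvg (y_ @ \oo).
  apply/cauchy_cvgP/cauchy_ballP => e e0; near_simpl.
  have K : \forall n \near \oo, n.+1%:R^-1 < e ^+ 2 * mu / 8 :> R.
    have k0 : 0 < e ^+ 2 * mu / 8 by rewrite divr_gt0 ?mulr_gt0 ?exprn_gt0.
    exact: near_infty_natSinv_lt (PosNum k0).
  near=> n k => /=.
  split=> // i j; rewrite ord1 /ball /=.
  have nK : n.+1%:R^-1 < e ^+ 2 * mu / 8 by near: n.
  have kK : k.+1%:R^-1 < e ^+ 2 * mu / 8 by near: k.
  rewrite -ltr_sqr ?nnegrE ?(ltW e0) // -normrX ger0_norm ?sqr_ge0 //.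
  apply: le_lt_trans (close n k j) _.
  rewrite mulrAC ltr_pdivrMr //; move: nK kK.
  by move: (n.+1%:R^-1) (k.+1%:R^-1) => a b; lra.
move=> /cvg_ex[p yp].
have Xp : X p.
  by apply: (closed_cvg _ clX _ _ yp) => //; near=> n; exact: (Hy n).1.
exists p; split=> // y Xy; apply: le_trans (Ilb y Xy).
rewrite leNgt; apply/negP => Ip.
(* Lower semicontinuity would keep [F (y_ n)] above the middle of [I] and [F p], while [F (y_ n)]
   tends to [I]. *)
have [||e e0 He] := lF p ((I + F p) / 2) => //; first lra.
have k0 : 0 < (F p - I) / 2 by lra.
near \oo => n.
have : (I + F p) / 2 < F (y_ n).
  apply: He; first exact: (Hy n).1.
  by near: n; move/cvg_ballP : yp; apply.
have : n.+1%:R^-1 < (F p - I) / 2.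
  by near: n; exact: near_infty_natSinv_lt (PosNum k0).
by have := (Hy n).2; move: (n.+1%:R^-1) => b; lra.
Unshelve. all: by end_near. Qed.

End StrongConvexity.

(** * The Moreau envelope, its prox point and its gradient *)

Section MoreauEnvelope.
Context {R : realType} {d : nat}.
Variables (X : set 'rV[R]_d) (phi : 'rV[R]_d -> R) (m c lambda : R).
Implicit Types (x y p h : 'rV[R]_d).
Hypotheses (cX : convex_set X) (phic : forall y, X y -> c <= phi y).
Hypotheses (sphi : strongly_convex X (- m) phi).
Hypotheses (lambda0 : 0 < lambda) (mlambda : m < lambda^-1).

Let obj x y := phi y + (2 * lambda)^-1 * enorm (y - x) ^+ 2.

Lemma moreau_le x y : X y ->
  moreau X lambda phi x <= phi y + (2 * lambda)^-1 * dotp (y - x) (y - x).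
Proof.
move=> Xy; rewrite -enorm_sqr; apply: ge_inf; last by exists y.
exists c => _ [z Xz <-]; rewrite -[c]addr0 lerD ?phic //.
by rewrite mulr_ge0 ?sqr_ge0 // invr_ge0 mulr_ge0 // ltW.
Qed.

Lemma moreau_ge x b : X !=set0 ->
  (forall y, X y -> b <= phi y + (2 * lambda)^-1 * dotp (y - x) (y - x)) ->
  b <= moreau X lambda phi x.
Proof.
move=> [z Xz] Hb; apply: lb_le_inf; first by exists (obj x z), z.
by move=> _ [y Xy <-]; rewrite enorm_sqr; exact: Hb.
Qed.

Lemma moreau_argmin x p : argmin X (obj x) p ->
  moreau X lambda phi x = phi p + (2 * lambda)^-1 * dotp (p - x) (p - x).
Proof.
move=> [Xp pmin]; apply/eqP; rewrite eq_le moreau_le //=.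
apply: moreau_ge => [|y Xy]; first by exists p.
by have := pmin y Xy; rewrite /obj !enorm_sqr.
Qed.

Lemma moreau_obj_strongly_convex x : strongly_convex X (lambda^-1 - m) (obj x).
Proof.
rewrite addrC /obj.
have -> : (2 * lambda)^-1 = lambda^-1 / 2 by rewrite invfM mulrC.
exact: strongly_convexD sphi (strongly_convex_quad _ _).
Qed.

Lemma prox_growth x p y : argmin X (obj x) p -> X y ->
  moreau X lambda phi x + (lambda^-1 - m) / 2 * dotp (y - p) (y - p) <=
  phi y + (2 * lambda)^-1 * dotp (y - x) (y - x).
Proof.
move=> px Xy; rewrite (moreau_argmin px).
have := argmin_growth cX (moreau_obj_strongly_convex x) px Xy.
by rewrite /obj !enorm_sqr.
Qed.

Lemma prox_exists x : closed X -> X !=set0 -> lsc_ball X phi ->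
  exists p, argmin X (obj x) p.
Proof.
move=> clX X0 lphi.
apply: (@argmin_exists _ _ X (lambda^-1 - m) c) => //.
- by rewrite subr_gt0.
- exact: moreau_obj_strongly_convex.
- apply: lsc_ballD => //; apply: lsc_ball_quad.
  by rewrite invr_ge0 mulr_ge0 // ltW.
- move=> y Xy; rewrite -[c]addr0 lerD ?phic //.
  by rewrite mulr_ge0 ?sqr_ge0 // invr_ge0 mulr_ge0 // ltW.
Qed.

(** Upper bound: [p] competes in the envelope at [h + x]. Lower bound: for any competitor [y], the
    growth term [mu / 2 * |y - p|^2] absorbs the cross term in [y - p] and [h] by Young's
    inequality, uniformly in [y]. *)
Lemma moreau_expansion x p : argmin X (obj x) p -> exists K : R, forall h,
  `|moreau X lambda phi (h + x) - moreau X lambda phi x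
    - lambda^-1 * dotp (x - p) h| <= K * dotp h h.
Proof.
move=> px; have Xp := px.1.
pose mu := lambda^-1 - m; have mu0 : 0 < mu by rewrite subr_gt0.
(* [K1] is the weight of [|h|^2] in the shifted penalty, [K2] the price of Young's inequality. *)
pose K1 := (2 * lambda)^-1; pose K2 := (2 * mu)^-1 * lambda^-1 ^+ 2.
have K10 : 0 <= K1 by rewrite invr_ge0 mulr_ge0 // ltW.
have K20 : 0 <= K2 by rewrite mulr_ge0 ?sqr_ge0 // invr_ge0 mulr_ge0 // ltW.
have lamE : lambda^-1 = 2 * K1 by rewrite /K1; field; rewrite gt_eqF.
exists (K1 + K2) => h; have h0 := dotp_ge0 h.
have K1h := mulr_ge0 K10 h0; have K2h := mulr_ge0 K20 h0.
have expand y : dotp (y - (h + x)) (y - (h + x)) =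
  dotp (y - x) (y - x) - 2 * dotp (y - p) h + 2 * dotp (x - p) h + dotp h h.
  rewrite !dotpE (dotpC h y) (dotpC x y) (dotpC h x); ring.
rewrite ler_norml; apply/andP; split; last first.
  have := moreau_le (h + x) Xp; rewrite expand (moreau_argmin px) subrr dotpC dotp0.
  by rewrite -/K1 lamE; lra.
suff : moreau X lambda phi x + lambda^-1 * dotp (x - p) h - K2 * dotp h h <=
    moreau X lambda phi (h + x) by lra.
apply: moreau_ge => [|y Xy]; first by exists p.
have mu20 : 0 < mu / 2 by rewrite divr_gt0.
have := dotp_young (y - p) (- (lambda^-1 *: h)) mu20.
have := prox_growth px Xy; rewrite -/mu expand -/K1.
have -> : (4 * (mu / 2))^-1 = (2 * mu)^-1 by congr (_^-1); field.
rewrite 2!dotpNr dotpNl opprK !dotpZr dotpZl.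
have -> : (2 * mu)^-1 * (lambda^-1 * (lambda^-1 * dotp h h)) = K2 * dotp h h.
  by rewrite /K2; ring.
by rewrite lamE; lra.
Qed.

Lemma derive_quadratic_remainder (F : 'rV[R]_d -> R) x v (l K : R) :
  (forall t : R, `|F (t *: v + x) - F x - t * l| <= K * t ^+ 2) ->
  'D_v F x = l.
Proof.
move=> H; apply: cvg_lim => //; apply/cvgrPdist_lt => e e0.
have K0 : 0 <= K by have := le_trans (normr_ge0 _) (H 1); rewrite expr1n mulr1.
(* The difference quotient is within [K * |t|] of [l]; [K + 1] avoids dividing by a zero [K]. *)
have k0 : 0 < e / (K + 1) by rewrite divr_gt0 // ltr_wpDl.
near=> t.
have t0 : t != 0 by near: t; exact: nbhs_dnbhs_neq.
have tlt : `|t| < e / (K + 1) by near: t; apply: dnbhs0_lt.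
have -> : l - t^-1 *: ((F \o shift x) (t *: v) - F x) =
  - (t^-1 * (F (t *: v + x) - F x - t * l)).
  by rewrite /= /GRing.scale /=; field.
have nt0 : 0 < `|t| by rewrite normr_gt0.
rewrite normrN normrM normfV mulrC ltr_pdivrMr //.
apply: le_lt_trans (H t) _; rewrite -normr_id -real_normK ?num_real //.
move: tlt; rewrite ltr_pdivlMr; last by lra.
move: nt0; rewrite normr_id; set s := `|t| => s0 tlt.
have : 0 < s * (e - s * (K + 1)) by rewrite mulr_gt0 // subr_gt0.
by have := mulr_gt0 s0 s0; lra.
Unshelve. all: by end_near. Qed.

Lemma gradient_moreau x p : argmin X (obj x) p ->
  gradient (moreau X lambda phi) x = lambda^-1 *: (x - p).
Proof.
move=> px; have [K HK] := moreau_expansion px.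
apply/rowP => i; rewrite !mxE.
apply: (@derive_quadratic_remainder _ _ _ _ K) => t.
have := HK (t *: delta_mx ord0 i); rewrite !dotpE !dotp_delta !mxE !eqxx.
by rewrite /= mulr1 -mulrBr mulrCA expr2.
Qed.

End MoreauEnvelope.

(** * One step of the method: descent of the envelope *)

Section ProxSubgradStep.
Context {R : realType} {d : nat}.
Variables (X : set 'rV[R]_d) (f r : 'rV[R]_d -> R) (rho eta lambda c : R).
Implicit Types (x y p g h : 'rV[R]_d).

Lemma dotp_subC x y : dotp (x - y) (x - y) = dotp (y - x) (y - x).
Proof. by rewrite -opprB dotpNl dotpNr opprK. Qed.

(** Expanding [|y|^2] around [x] moves the shift into the slope and leaves a quadratic defect. The
    two directions serve [subdiff_le] and [le_subdiff]. *)
Lemma quad_shift_dotp (m : R) (F : 'rV[R]_d -> R) x y v :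
  (quad_shift m F x + dotp v (y - x) <= quad_shift m F y) =
  (F x + dotp (v - m *: x) (y - x) - m / 2 * dotp (y - x) (y - x) <= F y).
Proof.
rewrite /quad_shift !enorm_sqr !dotpE (dotpC y x).
by apply/idP/idP; lra.
Qed.

Lemma subdiff_le (m : R) (F : 'rV[R]_d -> R) x y g : subdiff X m F x g -> X y ->
  F x + dotp g (y - x) - m / 2 * dotp (y - x) (y - x) <= F y.
Proof. by move=> [v Hv <-] Xy; rewrite -quad_shift_dotp; exact: Hv. Qed.

Lemma le_subdiff (m : R) (F : 'rV[R]_d -> R) x g :
  (forall y, X y -> F x + dotp g (y - x) - m / 2 * dotp (y - x) (y - x) <= F y) ->
  subdiff X m F x g.
Proof.
move=> H; exists (g + m *: x); last by rewrite addrK.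
by move=> y Xy; rewrite quad_shift_dotp addrK; exact: H.
Qed.

Hypotheses (cX : convex_set X).
Hypotheses (sf : strongly_convex X (- rho) f) (sr : strongly_convex X (- eta) r).

Let sub g a x y := dotp g y + r y + (2 * a)^-1 * enorm (y - x) ^+ 2.

Lemma half_inv (a : R) : (2 * a)^-1 = a^-1 / 2.
Proof. by rewrite invfM mulrC. Qed.

Lemma subproblem_growth g a x x' y : argmin X (sub g a x) x' -> X y ->
  dotp g x' + r x' + a^-1 / 2 * dotp (x' - x) (x' - x)
    + (a^-1 - eta) / 2 * dotp (y - x') (y - x') <=
  dotp g y + r y + a^-1 / 2 * dotp (y - x) (y - x).
Proof.
move=> x'min Xy.
have : strongly_convex X (0 + - eta + a^-1) (sub g a x).
  rewrite /sub half_inv; apply: strongly_convexD (strongly_convex_quad _ _).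
  exact: strongly_convexD (strongly_convex_dotp _) sr.
move=> /(argmin_growth cX)/(_ x'min Xy).
by rewrite add0r (addrC (- eta)) /sub half_inv !enorm_sqr.
Qed.

(** Optimality condition without a sum rule: in the growth inequality the [a^-1] squares collapse to
    a linear term, and only the [eta] defect of a weak subgradient remains. *)
Lemma subproblem_subgradient g a x x' : argmin X (sub g a x) x' ->
  subdiff X eta r x' (- (g + a^-1 *: (x' - x))).
Proof.
move=> x'min; apply: le_subdiff => y Xy.
have := subproblem_growth x'min Xy.
rewrite !dotpE (dotpC y x) (dotpC x' x) (dotpC y x'); lra.
Qed.

Hypotheses (phic : forall y, X y -> c <= (f \+ r) y).
Hypotheses (rho0 : 0 <= rho) (eta0 : 0 <= eta) (lambda0 : 0 < lambda).
Hypothesis (lambda_small : rho + 2 * eta < lambda^-1).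

Let m := rho + eta.
Let gap := (lambda^-1 - (rho + 2 * eta)) / 2.

Let mlambda : m < lambda^-1.
Proof. by move: eta0 lambda_small; rewrite /m; lra. Qed.

Lemma sum_strongly_convex : strongly_convex X (- m) (f \+ r).
Proof. by rewrite opprD; exact: strongly_convexD. Qed.

Let sphi := sum_strongly_convex.

Let prox x p := argmin X
  (fun y => (f \+ r) y + (2 * lambda)^-1 * enorm (y - x) ^+ 2) p.

Lemma enorm_gradient_moreau x p : prox x p ->
  enorm (gradient (moreau X lambda (f \+ r)) x) ^+ 2 =
  lambda^-1 ^+ 2 * dotp (p - x) (p - x).
Proof.
move=> px; rewrite (gradient_moreau cX phic sphi lambda0 mlambda px).
by rewrite enorm_sqr dotpZl dotpZr mulrA -expr2 dotp_subC.
Qed.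

(** Since [phi p >= c], the excess of the envelope over [c] dominates its penalty term, which is
    [lambda / 2] times the squared gradient. This reduces (B_4) to (B_3). *)
Lemma enorm_gradient_moreau_le x p : prox x p ->
  enorm (gradient (moreau X lambda (f \+ r)) x) ^+ 2 <=
  2 / lambda * (moreau X lambda (f \+ r) x - c).
Proof.
move=> px; rewrite (enorm_gradient_moreau px) (moreau_argmin phic lambda0 px).
have := phic px.1; move: (dotp _ _) (_ p) => D b cb.
rewrite half_inv; have l0 : 0 <= lambda^-1 by rewrite invr_ge0 ltW.
have : 0 <= lambda^-1 * (b - c) by rewrite mulr_ge0 // subr_ge0.
by lra.
Qed.

(** Common start of both cases: subproblem growth tested at [p], plus the subgradient inequality of
    [f] from [x] to [p]. *)
Lemma subproblem_prox_le g a x x' p : X x -> subdiff X rho f x g ->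
  argmin X (sub g a x) x' -> X p ->
  r x' - r p + f x - f p - rho / 2 * dotp (p - x) (p - x) + dotp g (x' - x)
    + a^-1 / 2 * dotp (x' - x) (x' - x) <=
  a^-1 / 2 * (dotp (p - x) (p - x) - dotp (p - x') (p - x'))
    + eta / 2 * dotp (p - x') (p - x').
Proof.
move=> Xx gx x'min Xp.
have := subdiff_le gx Xp; have := subproblem_growth x'min Xp.
rewrite (dotpDr g p) (dotpDr g x') dotpNr.
by move: (dotp (p - x) _) (dotp (p - x') _) (dotp (x' - x) _) => P Q S; lra.
Qed.

(** The old prox point [p] competes in the envelope at [x'], so the envelope changes by at most
    [(|p - x'|^2 - |p - x|^2) / (2 * lambda)]; the last premise is multiplied by [a / lambda]. *)
Lemma moreau_descent a x x' p E : 0 < a -> prox x p -> X x' ->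
  gap * dotp (p - x) (p - x) - E * a <=
    a^-1 / 2 * (dotp (p - x) (p - x) - dotp (p - x') (p - x')) ->
  moreau X lambda (f \+ r) x' <= moreau X lambda (f \+ r) x
    - lambda * gap * a * enorm (gradient (moreau X lambda (f \+ r)) x) ^+ 2
    + E / lambda * a ^+ 2.
Proof.
move=> a0 px Xx' H.
rewrite (enorm_gradient_moreau px) (moreau_argmin phic lambda0 px).
apply: le_trans (moreau_le phic lambda0 x' px.1) _; rewrite half_inv.
move: H; set P := dotp (p - x) _; set Q := dotp (p - x') _; set b := (f \+ r) p.
move=> H; have l0 : 0 < lambda^-1 by rewrite invr_gt0.
have {}H : 0 <= lambda^-1 * (a * (a^-1 / 2 * (P - Q) - (gap * P - E * a))).
  by rewrite !mulr_ge0 ?subr_ge0 // ltW.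
have E1 : lambda^-1 * (a * (a^-1 / 2 * (P - Q) - (gap * P - E * a))) =
  lambda^-1 / 2 * (P - Q) - lambda^-1 * gap * a * P + E / lambda * a ^+ 2.
  by field; rewrite !gt_eqF.
have E2 : lambda * gap * a * (lambda^-1 ^+ 2 * P) = lambda^-1 * gap * a * P.
  by field; rewrite gt_eqF.
by rewrite E2; lra.
Qed.

(** Prox growth is tested at [x'], so [f x] must be traded for [f x']. The subgradient [g'] does
    this, and Young's inequality splits the resulting product of [g - g'] and [x' - x]. *)
Lemma step_descent_bounded_subgradient a x x' g g' p L :
  0 < a -> 2 * (lambda^-1 + 2 * eta + rho) <= a^-1 ->
  X x -> subdiff X rho f x g -> subdiff X rho f x' g' ->
  dotp g g <= L -> dotp g' g' <= L ->
  argmin X (sub g a x) x' -> prox x p ->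
  moreau X lambda (f \+ r) x' <= moreau X lambda (f \+ r) x
    - lambda * gap * a * enorm (gradient (moreau X lambda (f \+ r)) x) ^+ 2
    + 4 * L / lambda * a ^+ 2.
Proof.
move=> a0 a_small Xx gx gx' gL gL' x'min px; have Xx' := x'min.1.
apply: (moreau_descent a0 px Xx').
have := subproblem_prox_le Xx gx x'min px.1.
have := subdiff_le gx' Xx.
have := prox_growth cX phic sphi lambda0 px Xx'.
rewrite (moreau_argmin phic lambda0 px) half_inv (dotp_subC x' p).
have := dotp_young (g - g') (x' - x) a0.
have -> : (4 * a)^-1 = a^-1 / 4 by rewrite invfM mulrC.
have := dotp_sum_sqr_le g (- g').
rewrite dotpNl dotpNr opprK (dotp_subC x x') -(opprB x' x) dotpNr (dotpDl g (- g') (x' - x)) dotpNl /=.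
have := dotp_ge0 (x' - x); have := dotp_ge0 (p - x); have := dotp_ge0 (p - x').
set P := dotp (p - x) _; set Q := dotp (p - x') _; set S := dotp (x' - x) (x' - x).
set T := dotp (g - g') (g - g').
move=> Q0 P0 S0 T4 Y H1 H2 H3.
have aT : 0 <= a * (4 * L - T) by apply: mulr_ge0; lra.
have bS : 0 <= (a^-1 - 2 * (lambda^-1 + 2 * eta + rho)) * S by rewrite mulr_ge0 // subr_ge0.
(* Prox growth supplies [(lambda^-1 - rho - eta) / 2] of [Q] and the subproblem spends [eta / 2];
   what is left is nonnegative by the bound on [lambda]. *)
have gQ : 0 <= (lambda^-1 - (rho + 2 * eta)) * Q by rewrite mulr_ge0 // subr_ge0 ltW.
have eP := mulr_ge0 eta0 P0; have eS := mulr_ge0 eta0 S0.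
have lS : 0 <= lambda^-1 * S by rewrite mulr_ge0 // invr_ge0 ltW.
have rS := mulr_ge0 rho0 S0.
by rewrite /gap; rewrite /m in H1; lra.
Qed.

(** Here prox growth is tested at [x], and [h] trades [r x'] for [r x], so only the sum [g + h]
    meets [x' - x]. *)
Lemma step_descent_bounded_sum a x x' g h p G :
  0 < a -> 6 * eta <= a^-1 ->
  X x -> subdiff X rho f x g -> subdiff X eta r x h ->
  dotp (g + h) (g + h) <= G ->
  argmin X (sub g a x) x' -> prox x p ->
  moreau X lambda (f \+ r) x' <= moreau X lambda (f \+ r) x
    - lambda * gap * a * enorm (gradient (moreau X lambda (f \+ r)) x) ^+ 2
    + G / lambda * a ^+ 2.
Proof.
move=> a0 a_small Xx gx hx ghG x'min px; have Xx' := x'min.1.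
apply: (moreau_descent a0 px Xx').
have := subproblem_prox_le Xx gx x'min px.1.
have := subdiff_le hx Xx'.
have := prox_growth cX phic sphi lambda0 px Xx.
rewrite (moreau_argmin phic lambda0 px) half_inv subrr dotp0 mulr0 addr0.
rewrite (dotp_subC x p).
have := dotp_young (g + h) (x' - x) a0.
have -> : (4 * a)^-1 = a^-1 / 4 by rewrite invfM mulrC.
have := dotp_sum_sqr_le (p - x) (x - x').
rewrite addrA addrNK (dotp_subC x x') (dotpDl g h (x' - x)) /=.
have := dotp_ge0 (x' - x); have := dotp_ge0 (p - x).
move: ghG; set T := dotp (g + h) (g + h).
set P := dotp (p - x) _; set Q := dotp (p - x') _; set S := dotp (x' - x) (x' - x).
move=> TG P0 S0 QPS Y H1 H2 H3.
have aT : 0 <= a * (G - T) by apply: mulr_ge0; lra.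
(* Origin of the 6: of the [a^-1 / 2] available on [S], Young's inequality takes [a^-1 / 4], the
   defect of [h] takes [eta / 2], and [Q <= 2 P + 2 S] takes [eta]. *)
have bS : 0 <= (a^-1 - 6 * eta) * S by rewrite mulr_ge0 // subr_ge0.
have eQ : 0 <= eta * (2 * P + 2 * S - Q) by rewrite mulr_ge0 // subr_ge0.
have gP : 0 <= (lambda^-1 - (rho + 2 * eta)) * P by rewrite mulr_ge0 // subr_ge0 ltW.
have eP := mulr_ge0 eta0 P0.
by rewrite /gap; rewrite /m in H1; lra.
Qed.

End ProxSubgradStep.

(** * Real recursions with [1/k] contraction and [1/k^2] error *)

Section RecursionRate.
Context {R : realType}.
Implicit Types (a : nat -> R) (C : R).

Lemma inv_succ_spec (k : nat) : (2 <= k)%N ->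
  [/\ 0 < (k%:R^-1 : R), 0 < (k.+1%:R^-1 : R), (k%:R^-1 : R) <= 1 / 2 &
      (k.+1%:R^-1 : R) = k%:R^-1 - k%:R^-1 * k.+1%:R^-1].
Proof.
move=> k2; have k0 : 0 < (k%:R : R) by rewrite ltr0n; exact: leq_trans k2.
split; [by rewrite invr_gt0 | by rewrite invr_gt0 ltr0n | | ].
  by rewrite div1r lef_pV2 ?posrE // ler_nat.
rewrite -natr1; move: k%:R k0 => z z0.
by field; rewrite !gt_eqF // addr_gt0.
Qed.

(* [a k + 2 C / k] is eventually nonincreasing with limit 0. *)
Lemma recursion_lower_bound a C : 0 <= C -> a @ \oo --> (0 : R) ->
  (\forall k \near \oo, a k.+1 <= a k + C * k%:R^-1 ^+ 2) ->
  \forall k \near \oo, - (2 * C) * k%:R^-1 <= a k.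
Proof.
move=> C0 a0 [K _ HK]; exists (maxn K 2) => // k /=.
rewrite geq_max => /andP[Kk k2].
have mono n : a (k + n)%N + 2 * C * (k + n)%:R^-1 <= a k + 2 * C * k%:R^-1.
  elim: n => [|n IHn]; first by rewrite addn0.
  apply: le_trans IHn; rewrite addnS.
  have [u0 v0 u2 vE] := inv_succ_spec (leq_trans k2 (leq_addr n k)).
  have := HK (k + n)%N (leq_trans Kk (leq_addr n k)).
  move: (a _) (a _) => b' b; move: (k + n)%:R^-1 (k + n).+1%:R^-1 u0 v0 u2 vE => u v.
  move=> u0 v0 u2 vE ab.
  (* This gives [C u^2 <= 2 C u v = 2 C (u - v)], so the error is paid by the drop of [2 C / k]. *)
  have uv : u <= 2 * v by nra.
  have : 0 <= C * (u * (2 * v - u)) by rewrite !mulr_ge0 ?subr_ge0 // ltW.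
  have -> : v = u - u * v by [].
  by rewrite {2}vE; lra.
rewrite leNgt; apply/negP => ak.
(* A negative value of the nonincreasing quantity would keep [a] away from its limit 0. *)
have d0 : 0 < - (a k + 2 * C * k%:R^-1) by lra.
have [N _ HN] : \forall n \near \oo, `|a n| < - (a k + 2 * C * k%:R^-1).
  by move/cvgr0_norm_lt : a0; apply.
have := HN (k + N)%N (leq_addl _ _); have := mono N.
have : 0 <= 2 * C * (k + N)%:R^-1 by rewrite !mulr_ge0 // invr_ge0.
by rewrite ltr_norml => ? ? /andP[]; lra.
Qed.

Lemma recursion_upper_bound a C : 0 <= C ->
  (\forall k \near \oo, a k.+1 <= a k + C * k%:R^-1 ^+ 2) ->
  (\forall k \near \oo,
     0 < a k -> a k.+1 <= (1 - 2 * k%:R^-1) * a k + C * k%:R^-1 ^+ 2) ->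
  exists2 M, 0 <= M & \forall k \near \oo, a k <= M * k%:R^-1.
Proof.
move=> C0 [K1 _ HK1] [K2 _ HK2].
(* From 2 on, the factor [1 - 2 / k] is nonnegative. *)
pose K := maxn (maxn K1 K2) 2.
have /andP[/andP[KK1 KK2] K2'] : (K1 <= K)%N && (K2 <= K)%N && (2 <= K)%N.
  by rewrite -!geq_max.
have K0 : 0 < (K%:R : R) by rewrite ltr0n; exact: leq_trans K2'.
(* The second summand settles the base case at [K]; [2 * C <= M] drives the induction. *)
pose M := 2 * C + `|a K| * K%:R.
have M0 : 0 <= M by rewrite addr_ge0 ?mulr_ge0 // ltW.
have CM : 2 * C <= M by rewrite lerDl mulr_ge0 // ltW.
exists M => //; exists K => // k /=.
elim: k => [|k IHk]; first by rewrite leqn0 => /eqP E; rewrite E ltxx in K0.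
rewrite leq_eqVlt => /orP[/eqP <-|].
  rewrite /M mulrDl mulfK ?gt_eqF //; apply: le_trans (ler_norm _) _.
  by rewrite lerDr !mulr_ge0 // invr_ge0 ltW.
rewrite ltnS => Kk; have {}IHk := IHk Kk.
have [u0 v0 u2 vE] := inv_succ_spec (leq_trans K2' Kk).
have := HK1 k (leq_trans KK1 Kk); have := HK2 k (leq_trans KK2 Kk).
move: (a _.+1) (a _) IHk => b' b.
move: k%:R^-1 k.+1%:R^-1 u0 v0 u2 vE => u v u0 v0 u2 vE bM Hpos Hneg.
have {}u0 := ltW u0.
have uv : v <= u by nra.
have CMu : 0 <= (M - 2 * C) * (u * u) by rewrite !mulr_ge0 // subr_ge0.
have Muv : 0 <= M * (u * (u - v)) by rewrite !mulr_ge0 // subr_ge0.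
have Muu : 0 <= M * (u * u) by rewrite !mulr_ge0.
(* For [b > 0] the contraction gains [2 M u^2], covering both [C u^2] and [u - v = u v <= u^2]. For
   [b <= 0] the error [C u^2] alone lies below [M v]. *)
rewrite vE; have [b0|b0] := ltP 0 b.
  have := Hpos b0.
  have : 0 <= (1 - 2 * u) * (M * u - b) by apply: mulr_ge0; lra.
  lra.
have Mu1 : 0 <= M * (u * (1 - 2 * u)) by rewrite !mulr_ge0 //; lra.
lra.
Qed.

Lemma recursion_bigO a C : 0 <= C -> a @ \oo --> (0 : R) ->
  (\forall k \near \oo, a k.+1 <= a k + C * k%:R^-1 ^+ 2) ->
  (\forall k \near \oo,
     0 < a k -> a k.+1 <= (1 - 2 * k%:R^-1) * a k + C * k%:R^-1 ^+ 2) ->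
  a =O_\oo (fun k => k%:R^-1 : R).
Proof.
move=> C0 a0 Hneg Hpos; have lower := recursion_lower_bound C0 a0 Hneg.
have [M M0 upper] := recursion_upper_bound C0 Hneg Hpos.
apply/eqO_exP; exists (M + 2 * C + 1); first by lra.
near=> k.
have u0 : 0 <= (k%:R^-1 : R) by rewrite invr_ge0.
have : - (2 * C) * k%:R^-1 <= a k by near: k.
have : a k <= M * k%:R^-1 by near: k.
have := mulr_ge0 M0 u0; have := mulr_ge0 C0 u0.
by rewrite (ger0_norm u0) ler_norml => *; apply/andP; split; lra.
Unshelve. all: by end_near. Qed.

End RecursionRate.

(** Removes the convention [1/0 = +oo]: for [b = 0] the conclusion is just positivity of [a^-1]. *)
Lemma lt_inve (R : realType) (a b : R) : 0 < a -> 0 <= b ->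
  (a%:E < b%:E^-1)%E -> b < a^-1.
Proof.
move=> a0 b0; rewrite inver; case: eqP => [-> _|/eqP bn0]; first by rewrite invr_gt0.
have bp : 0 < b by rewrite lt_neqAle eq_sym bn0.
by rewrite lte_fin -ltf_pV2 ?posrE ?invr_gt0 // invrK.
Qed.

(** * Descent along the whole sequence under each condition *)

Section ProxSubgradConvergence.
Context {R : realType} {d : nat}.
Variables (X : set 'rV[R]_d) (f r : 'rV[R]_d -> R) (rho eta lambda phistar : R).
Hypotheses (clX : closed X) (cX : convex_set X).
Hypotheses (lf : lsc_on X f) (lr : lsc_on X r).
Hypothesis (phi_min : min_value X (f \+ r) phistar).
Hypotheses (rho0 : 0 <= rho) (eta0 : 0 <= eta).
Hypotheses (wf : weakly_convex X rho f) (wr : weakly_convex X eta r).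
Hypotheses (lambda0 : 0 < lambda) (lambda_small : rho + 2 * eta < lambda^-1).

Let phi := f \+ r.
Let sf := weakly_convex_strongly wf.
Let sr := weakly_convex_strongly wr.

Let phic y : X y -> phistar <= phi y.
Proof. by move=> Xy; have [z [Xz zmin] <-] := phi_min; exact: zmin. Qed.

Let proxP x : exists p,
  argmin X (fun y => phi y + (2 * lambda)^-1 * enorm (y - x) ^+ 2) p.
Proof.
apply: (prox_exists cX phic (sum_strongly_convex sf sr) lambda0) => //.
- by move: eta0 lambda_small; lra.
- by have [z [Xz _] _] := phi_min; exists z.
- exact: lsc_ballD (lsc_onP lf) (lsc_onP lr).
Qed.

Lemma cond_B4_B3 : cond_B4 X rho eta lambda f r ->
  cond_B3 X rho eta lambda phistar f r.
Proof.
move=> [c5 [c6 [c50 c60 H]]]; exists (c5 * (2 / lambda)), c6; split=> //.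
  by rewrite !mulr_ge0 // invr_ge0 ltW.
move=> x g h Xx gx hx; apply: le_trans (H x g h Xx gx hx) _.
rewrite ler_wsqrtr // lerD2r -mulrA ler_wpM2l //.
have [p px] := proxP x.
exact: (enorm_gradient_moreau_le cX sf sr phic eta0 lambda0 lambda_small px).
Qed.

Lemma prox_subgrad_mem x g alpha k : prox_subgrad X rho f r x g alpha -> X (x k).
Proof. by case: k => [[]//|k [_ /(_ k)[_ _ []]]]. Qed.

Let descent (x : nat -> 'rV[R]_d) (alpha : nat -> R) (E : R) (k : nat) :=
  moreau X lambda phi (x k.+1) <= moreau X lambda phi (x k)
    - lambda * ((lambda^-1 - (rho + 2 * eta)) / 2) * alpha k
        * enorm (gradient (moreau X lambda phi) (x k)) ^+ 2
    + E * alpha k ^+ 2.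

Lemma prox_subgrad_descent_BDD x g alpha : cond_BDD X rho f ->
  prox_subgrad X rho f r x g alpha ->
  (forall k, alpha k < (2 * (lambda^-1 + 2 * eta + rho))^-1) ->
  exists2 E : R, 0 <= E & forall k, descent x alpha E k.
Proof.
move=> [L HL] algo alpha_lt; have [_ step] := algo.
have Xx k := prox_subgrad_mem k algo.
have gL k : dotp (g k) (g k) <= L ^+ 2.
  have [gk _ _] := step k; have := HL _ _ (Xx k) gk; rewrite -enorm_sqr => gL.
  by rewrite lerXn2r // nnegrE ?enorm_ge0 // (le_trans (enorm_ge0 _) gL).
exists (4 * L ^+ 2 / lambda).
  by apply: divr_ge0 (ltW lambda0); rewrite mulr_ge0 ?sqr_ge0.
(* The subgradient of [f] at the new iterate is the one the method picks in its next step. *)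
move=> k; have [gk ak xk] := step k; have [gk' _ _] := step k.+1.
have [p px] := proxP (x k).
apply: (step_descent_bounded_subgradient cX sf sr phic rho0 eta0 lambda0
  lambda_small _ _ (Xx k) gk gk' (gL k) (gL k.+1) xk px) => //.
have l0 : 0 < lambda^-1 by rewrite invr_gt0.
have b0 : 0 < 2 * (lambda^-1 + 2 * eta + rho) by move: eta0 rho0; lra.
by rewrite -lef_pV2 ?posrE ?invr_gt0 // invrK ltW.
Qed.

(* The optimality condition of the previous subproblem provides the subgradient
   of [r] at [x k] to which (B_3) is applied; hence no claim is made at [k = 0]. *)
Lemma prox_subgrad_descent_B3 x g alpha (phibar : R) :
  cond_B3 X rho eta lambda phistar f r ->
  prox_subgrad X rho f r x g alpha ->
  (forall k, 6 * eta < (alpha k)^-1) ->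
  (fun k => moreau X lambda phi (x k)) @ \oo --> phibar ->
  exists2 E : R, 0 <= E & \forall k \near \oo, descent x alpha E k.
Proof.
move=> [c3 [c4 [c30 c40 H]]] algo alpha_lt conv; have [_ step] := algo.
have Xx k := prox_subgrad_mem k algo.
(* Bounds the radicand of (B_3) once the envelope is below [phibar + 1]; the absolute value makes
   [G] nonnegative. *)
pose G := c3 * `|phibar + 1 - phistar| + c4.
have G0 : 0 <= G by rewrite addr_ge0 ?mulr_ge0.
exists (G / lambda); first by rewrite divr_ge0 // ltW.
near=> k; have [gk ak xk] := step k.
have k0 : (0 < k)%N by near: k; exact: nbhs_infty_gt.
have [h hk] : exists h, subdiff X eta r (x k) h.
  move: k0; case: (k) => // k' _; have [_ _ xk'] := step k'.
  by eexists; exact: (subproblem_subgradient cX sr xk').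
have [p px] := proxP (x k).
apply: (step_descent_bounded_sum cX sf sr phic eta0 lambda0 lambda_small
  ak _ (Xx k) gk hk _ xk px); first exact: ltW.
rewrite -enorm_sqr -(sqr_sqrtr G0).
rewrite lerXn2r ?nnegrE ?enorm_ge0 ?sqrtr_ge0 //.
apply: le_trans (H _ _ _ (Xx k) gk hk) _.
rewrite ler_wsqrtr // lerD2r ler_wpM2l //.
apply: le_trans (ler_norm _); rewrite lerD2r.
have : `|phibar - moreau X lambda phi (x k)| < 1.
  by near: k; move/cvgrPdist_lt : conv; apply.
by rewrite ltr_norml => /andP[]; lra.
Unshelve. all: by end_near. Qed.

End ProxSubgradConvergence.

(** * The rate, from descent, the KL inequality and the recursion *)

Theorem theorem4p2 (R : realType) (d : nat) (X : set 'rV[R]_d)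
    (f r : 'rV[R]_d -> R) (rho eta lambda phistar : R)
    (xbar : 'rV[R]_d) (phibar kappa eps nu : R) (betabar : \bar R) :
  let phi := f \+ r in
  let phi_lambda := moreau X lambda phi in
  let Omega := [set x | X x /\ phi_lambda x = phibar] in
  closed X -> convex_set X ->
  lsc_on X f -> lsc_on X r ->
  min_value X phi phistar ->
  0 <= rho -> 0 <= eta ->
  weakly_convex X rho f -> weakly_convex X eta r ->
  0 < lambda -> (lambda%:E < (rho + 2 * eta)%:E^-1)%E ->
  X xbar -> phibar = phi_lambda xbar -> local_min_value X phi phibar ->
  0 < kappa -> 0 < eps -> 0 < nu ->
  uniform_KL X phi_lambda phibar kappa eps nu ->
  stepsize_bound X rho eta lambda phistar f r betabar ->
  exists2 Delta0 : R, 0 < Delta0 & forall Delta2 : R, Delta0 <= Delta2 ->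
    forall (x g : nat -> 'rV[R]_d) (alpha : nat -> R),
    prox_subgrad X rho f r x g alpha ->
    (fun k => phi_lambda (x k)) @ \oo --> phibar ->
    (\forall k \near \oo, dist_to (x k) Omega <= eps) ->
    (forall k, ((alpha k)%:E < betabar)%E) ->
    (\forall k \near \oo, alpha k = Delta2 / k%:R) ->
    (fun k => phi_lambda (x k) - phibar) =O_\oo (fun k => (k%:R)^-1 : R).
Proof.
move=> phi phi_lambda Omega clX cX lf lr phi_min rho0 eta0 wf wr lambda0.
move=> lambda_lt _ _ _ kappa0 _ nu0 KL bound.
have lambda_small : rho + 2 * eta < lambda^-1.
  by apply: lt_inve lambda_lt => //; rewrite addr_ge0 ?mulr_ge0.
pose c := lambda * ((lambda^-1 - (rho + 2 * eta)) / 2).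
have c0 : 0 < c by rewrite !mulr_gt0 // subr_gt0.
have ck0 : 0 < c * kappa by rewrite mulr_gt0.
have D0 : 0 < 2 / (c * kappa) by rewrite divr_gt0.
(* With this threshold [c * kappa * alpha k >= 2 / k], the contraction that the recursion
   requires. *)
exists (2 / (c * kappa)) => // Delta2 Delta_ge x g alpha algo conv near_Omega.
move=> alpha_lt alphaE; have Xx k := prox_subgrad_mem k algo.
have alpha0 k : 0 < alpha k by have [_ /(_ k)[]] := algo.
have [E E0 HE] : exists2 E : R, 0 <= E & \forall k \near \oo,
    phi_lambda (x k.+1) <= phi_lambda (x k)
      - c * alpha k * enorm (gradient phi_lambda (x k)) ^+ 2 + E * alpha k ^+ 2.
  case: bound => [[BDD bE]|[B34 bE]].
    have [k|E E0 HE] := prox_subgrad_descent_BDD clX cX lf lr phi_min rho0 eta0 wf wr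
      lambda0 lambda_small BDD algo.
      by rewrite -lte_fin -bE.
    by exists E => //; near=> k; exact: HE.
  have B3 : cond_B3 X rho eta lambda phistar f r.
    by case: B34 => // /cond_B4_B3; apply.
  apply: (prox_subgrad_descent_B3 clX cX lf lr phi_min eta0 wf wr
    lambda0 lambda_small B3 algo _ conv) => k.
  by apply: lt_inve; rewrite ?mulr_ge0 // -bE.
have Delta0 : 0 < Delta2 by exact: lt_le_trans Delta_ge.
apply: (@recursion_bigO _ _ (E * Delta2 ^+ 2)).
- by rewrite mulr_ge0 ?sqr_ge0.
- by apply/subr_cvg0.
- near=> k.
  have aE : alpha k = Delta2 / k%:R by near: k.
  have : phi_lambda (x k.+1) <= phi_lambda (x k)
      - c * alpha k * enorm (gradient phi_lambda (x k)) ^+ 2 + E * alpha k ^+ 2.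
    by near: k.
  have : 0 <= c * alpha k * enorm (gradient phi_lambda (x k)) ^+ 2.
    by rewrite mulr_ge0 ?sqr_ge0 // ltW // mulr_gt0.
  have -> : E * alpha k ^+ 2 = E * Delta2 ^+ 2 * k%:R^-1 ^+ 2.
    by rewrite aE exprMn mulrA.
  lra.
(* A positive gap is the strict lower bound in the KL region; the upper level bound comes from
   convergence. *)
- near=> k; rewrite subr_gt0 => phik.
  have aE : alpha k = Delta2 / k%:R by near: k.
  have : phi_lambda (x k.+1) <= phi_lambda (x k)
      - c * alpha k * enorm (gradient phi_lambda (x k)) ^+ 2 + E * alpha k ^+ 2.
    by near: k.
  have -> : E * alpha k ^+ 2 = E * Delta2 ^+ 2 * k%:R^-1 ^+ 2.
    by rewrite aE exprMn mulrA.
  have phik_lt : phi_lambda (x k) < phibar + nu.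
    have : `|phibar - phi_lambda (x k)| < nu.
      by near: k; move/cvgrPdist_lt : conv; apply.
    by rewrite ltr_norml => /andP[]; lra.
  have dist_le : dist_to (x k) Omega <= eps by near: k.
  have := KL (x k) (Xx k) dist_le phik phik_lt.
  rewrite -/phi_lambda; set N := enorm _ ^+ 2; set a := phi_lambda (x k) - phibar.
  move=> KLk.
  have : c * alpha k * (kappa * a) <= c * alpha k * N.
    by rewrite ler_wpM2l // mulr_ge0 // ltW.
  suff : 2 * k%:R^-1 * a <= c * alpha k * (kappa * a) by rewrite /a; lra.
  rewrite mulrA ler_wpM2r ?subr_ge0 ?(ltW phik) // aE.
  have -> : c * (Delta2 / k%:R) * kappa = c * kappa * Delta2 * k%:R^-1 by ring.
  rewrite ler_wpM2r ?invr_ge0 //.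
  by move: Delta_ge; rewrite ler_pdivrMr // mulrC.
Unshelve. all: by end_near. Qed.
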